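(* Suppose that $X$ is a nonempty paracompact free $\mathbb{Z}_2$-space. Then \[\mathrm{secat}(X\to X/\mathbb{Z}_2)=\mathrm{ind}_2(X,\mathbb{Z}_2)+1\] (with both sides taking values in the nonnegative integers together with $\infty$, and $\infty+1=\infty$).
   Context: ''Space'' means topological space and ''map'' means continuous map. A free $\mathbb{Z}_2$-space is a Hausdorff space $X$ with a free left action of the group $\mathbb{Z}_2$ of order two (equivalently, a fixed-point free involution); $X\to X/\mathbb{Z}_2$ denotes the quotient map (a fibration). For a space $Y$, $F(Y,2,2)=\{(y_1,y_2)\in Y^2: y_1\neq y_2\}$ with the subspace topology, on which the generator of $\mathbb{Z}_2$ acts by $(y_1,y_2)\mapsto(y_2,y_1)$. The index $\mathrm{ind}_2(X,\mathbb{Z}_2)$ is the least integer $k\in\{0,1,2,\ldots\}$ such that there exists a $\mathbb{Z}_2$-equivariant map $X\to F(\mathbb{R}^{k+1},2,2)$, and $\mathrm{ind}_2(X,\mathbb{Z}_2)=\infty$ if no such $k$ exists. For a fibration $\pi:E\to B$, the sectional category $\mathrm{secat}(\pi)$ is the minimal cardinality of an open cover of $B$ such that each element $U$ of the cover admits a local section of $\pi$ (a map $s:U\to E$ with $\pi\circ s$ equal to the inclusion $U\hookrightarrow B$); $\mathrm{secat}(\pi)=\infty$ if no such finite cover exists. *)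

(* Defs.v *)
From HB Require Import structures.
From mathcomp Require Import all_boot all_order all_algebra generic_quotient.
From mathcomp Require Import all_classical all_reals topology.

Set Implicit Arguments.
Unset Strict Implicit.
Unset Printing Implicit Defensive.

Import GRing.Theory.
Import numFieldTopology.Exports.

Local Open Scope quotient_scope.
Local Open Scope classical_set_scope.
Local Open Scope ring_scope.

Definition open_cover (T : topologicalType) (C : set (set T)) : Prop :=
  (forall U, C U -> open U) /\ \bigcup_(U in C) U = [set: T].

Definition locally_finite (T : topologicalType) (C : set (set T)) : Prop :=
  forall x : T, exists2 V, nbhs x V & finite_set [set U | C U /\ U `&` V !=set0].

Definition paracompact (T : topologicalType) : Prop :=
  forall C : set (set T), open_cover C ->
    exists D : set (set T), [/\ open_cover D,
      forall V, D V -> exists2 U, C U & V `<=` U & locally_finite D].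

(* The least [k] satisfying [P], and [+oo] if there is none. *)
Definition least (P : nat -> Prop) : \bar nat :=
  match pselect (exists k, `[< P k >]) with
  | left h => (ex_minn h)%:E
  | right _ => +oo%E
  end.

(* 'Z_2 is discrete, so that joint continuity of the action amounts to
   continuity of the translations. *)
Record Z2_action (X : topologicalType) := Z2Action {
  Z2_act :> 'Z_2 -> X -> X;
  Z2_act0 : forall x, Z2_act 0 x = x;
  Z2_actD : forall g h x, Z2_act (g + h) x = Z2_act g (Z2_act h x);
  Z2_act_continuous : forall g, continuous (Z2_act g)
}.

Definition free_action (X : topologicalType) (a : Z2_action X) : Prop :=
  forall (g : 'Z_2) (x : X), a g x = x -> g = 0.

Definition free_Z2_space (X : topologicalType) (a : Z2_action X) : Prop :=
  hausdorff_space X /\ free_action a.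

Definition equivariant (X Y : topologicalType) (a : Z2_action X)
    (b : Z2_action Y) (f : X -> Y) : Prop :=
  forall (g : 'Z_2) (x : X), f (a g x) = b g (f x).

Section Orbits.
Variables (X : topologicalType) (a : Z2_action X).

Definition orbit_rel : rel X := fun x y => [exists g : 'Z_2, a g x == y].

Lemma orbit_rel_refl : reflexive orbit_rel.
Proof. by move=> x; apply/existsP; exists 0; rewrite Z2_act0. Qed.

Lemma orbit_rel_sym : symmetric orbit_rel.
Proof.
suff H x y : orbit_rel x y -> orbit_rel y x by move=> x y; apply/idP/idP => /H.
move=> /existsP[g /eqP <-]; apply/existsP; exists (- g).
by rewrite -Z2_actD addNr Z2_act0.
Qed.

Lemma orbit_rel_trans : transitive orbit_rel.
Proof.
move=> y x z /existsP[g /eqP <-] /existsP[h /eqP <-]; apply/existsP.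
by exists (h + g); rewrite Z2_actD.
Qed.

Definition orbit_equiv : equiv_rel X :=
  EquivRel orbit_rel orbit_rel_refl orbit_rel_sym orbit_rel_trans.

Definition orbit_space : topologicalType :=
  quotient_topology {eq_quot orbit_equiv}.

Definition orbit_proj : X -> orbit_space := \pi_orbit_space.

End Orbits.

Section ConfigurationSpace.
Variable Y : topologicalType.

(* As a type, this carries the subspace topology. *)
Definition conf2 : set (Y * Y) := [set y | y.1 <> y.2].

Lemma conf2_swap_subproof (y : conf2) : ((val y).2, (val y).1) \in conf2.
Proof. by case: y => -[y1 y2] /= /set_mem h; apply/mem_set => /= /esym. Qed.

Definition conf2_swap (y : conf2) : conf2 :=
  exist (fun z => z \in conf2) ((val y).2, (val y).1) (conf2_swap_subproof y).

Definition conf2_act (g : 'Z_2) (y : conf2) : conf2 :=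
  if g == 0 then y else conf2_swap y.

Lemma conf2_swapK : involutive conf2_swap.
Proof. by move=> [[y1 y2] h]; exact: eq_sig_hprop. Qed.

Lemma conf2_act0 (y : conf2) : conf2_act 0 y = y.
Proof. by []. Qed.

Lemma conf2_actD (g h : 'Z_2) (y : conf2) :
  conf2_act (g + h) y = conf2_act g (conf2_act h y).
Proof.
case: g => -[|[|//]] ?; case: h => -[|[|//]] ?; rewrite /conf2_act //=.
by rewrite conf2_swapK.
Qed.

Lemma conf2_act_continuous (g : 'Z_2) : continuous (conf2_act g).
Proof.
rewrite /conf2_act; case: (g == 0) => y; first exact: cvg_id.
apply: continuous_comp_initial => z.
apply: (@continuous_comp _ _ _ (set_val : conf2 -> _)
  (fun z => (z.2, z.1))).
  exact: initial_continuous.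
exact: swap_continuous.
Qed.

Definition conf2_Z2 : Z2_action conf2 :=
  Z2Action conf2_act0 conf2_actD conf2_act_continuous.

End ConfigurationSpace.

Arguments conf2 : clear implicits.
Arguments conf2_Z2 : clear implicits.

Definition ind2 (R : realType) (X : topologicalType) (a : Z2_action X) :
    \bar nat :=
  least (fun k => exists f : X -> conf2 'rV[R]_k.+1,
    continuous f /\ equivariant a (conf2_Z2 'rV[R]_k.+1) f).

Definition has_local_section (E B : topologicalType) (p : E -> B)
    (U : set B) : Prop :=
  exists s : U -> E, continuous s /\ p \o s = set_val.

Definition secat (E B : topologicalType) (p : E -> B) : \bar nat :=
  least (fun n => exists C : set (set B), [/\ (C #= `I_n)%card, open_cover C &
    forall U, C U -> has_local_section p U]).

(* Main.v *)
(* Each side is governed by families V_0, ..., V_(n-1) of open subsets of X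
   with V_i disjoint from its translate, such that the V_i and their translates
   cover X.  A local section over an open U of the orbit space amounts to such
   a V_i, namely its image (open because X is Hausdorff), with U the projection
   of V_i; and an equivariant map (f, f') to the configuration space of R^n
   yields V_i = {f'_i < f_i}.  Conversely, X is normal, being paracompact
   Hausdorff, so Urysohn functions give symmetric maps psi_i >= 0 vanishing
   outside V_i and its translate and not all zero at any point; the map
   h = (psi_i 1_(V_i))_i is continuous and (h, h o tau) is equivariant into the
   configuration space. *)
Require Import Defs.
From mathcomp Require Import all_boot all_order all_algebra generic_quotient.
From mathcomp Require Import all_classical all_reals topology.
From mathcomp Require Import normedtype.

Set Implicit Arguments.
Unset Strict Implicit.
Unset Printing Implicit Defensive.

Import Order.TTheory GRing.Theory Num.Theory.
Import numFieldNormedType.Exports.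

Local Open Scope classical_set_scope.
Local Open Scope ring_scope.

(** The hypotheses transfer existence both ways, so both minima are finite or both infinite. Bounds
    in place of exact values suffice, since each is applied at a minimum. *)
Lemma least_succ (P Q : nat -> Prop) :
    (forall m, P m -> exists2 k, (k < m)%N & Q k) ->
    (forall k, Q k -> exists2 m, (m <= k.+1)%N & P m) ->
  least P = (least Q + 1%:E)%E.
Proof.
move=> PQ QP; rewrite /least.
case: pselect => [hP|nP]; case: pselect => [hQ|nQ] //.
- case: ex_minnP => m /asboolP Pm mmin; case: ex_minnP => k /asboolP Qk kmin.
  suff -> : m = k.+1 by rewrite -addn1.
  apply/eqP; rewrite eqn_leq; apply/andP; split.
    have [m' m'k Pm'] := QP _ Qk.
    by apply: leq_trans m'k; apply: mmin; apply/asboolP.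
  have [k' k'm Qk'] := PQ _ Pm.
  by apply: leq_ltn_trans k'm; apply: kmin; apply/asboolP.
- exfalso; case: hP => m /asboolP /PQ[k _ Qk]; case: nQ.
  by exists k; apply/asboolP.
- exfalso; case: hQ => k /asboolP /QP[m _ Pm]; case: nP.
  by exists m; apply/asboolP.
Qed.

(** * Paracompact Hausdorff spaces are normal *)

Section ParacompactNormal.
Variable X : topologicalType.

Lemma disjoint_open_closure (U V : set X) :
  open V -> U `&` V = set0 -> closure U `<=` ~` V.
Proof.
move=> oV UV0; rewrite (closure_id (~` V)).1; last exact: open_closedC.
by apply: closureS; apply/disjoints_subset.
Qed.

(** [W] is the union of the members of a locally finite refinement that meet [A]; their closures
    miss [B], and local finiteness gives each point of [B] a neighbourhood avoiding [W]. *)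
Lemma paracompact_separation (A B : set X) :
    paracompact X -> closed A ->
    (forall x, A x -> exists2 U, open U & U x /\ closure U `<=` ~` B) ->
  exists W V, [/\ open W, open V, A `<=` W, B `<=` V & W `&` V = set0].
Proof.
move=> pcX cA AB.
have [|D [[oD covD] refD lfD]] :=
    pcX [set U | open U /\ (closure U `<=` ~` B \/ U `<=` ~` A)].
  split=> [U [] //|]; rewrite -subTset => x _.
  have [Ax|nAx] := pselect (A x).
    by have [U oU [Ux UB]] := AB x Ax; exists U => //; split=> //; left.
  by exists (~` A) => //; split; [exact: closed_openC|right].
pose W := \bigcup_(V in [set V | D V /\ V `&` A !=set0]) V.
have clW V : D V -> V `&` A !=set0 -> closure V `<=` ~` B.
  move=> DV [x [Vx Ax]]; have [U [_ [UB|UA]] VU] := refD _ DV.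
    by apply: subset_trans UB; exact: closureS.
  by have := UA _ (VU _ Vx).
exists W, (~` W)°; split.
- by apply: bigcup_open => V [DV _]; exact: oD.
- exact: open_interior.
- move=> x Ax; have : [set: X] x by [].
  by rewrite -covD => -[V DV Vx]; exists V => //; split=> //; exists x.
- move=> y By; have [N yN fN] := lfD y.
  (* [N] meets finitely many members, so [K] is closed; it misses [y], and removing it from [N]
     leaves a neighbourhood disjoint from [W]. *)
  pose K := \bigcup_(V in [set V | (D V /\ V `&` N !=set0) /\ V `&` A !=set0])
              closure V.
  have cK : closed K.
    apply: closed_bigcup => [|V _]; last exact: closed_closure.
    by apply: sub_finite_set fN => V [].
  have nKy : ~ K y by case=> V [[DV _] VA] /(clW V DV VA).
  have : nbhs y (N `&` ~` K).
    apply: filterI yN _; apply: open_nbhs_nbhs.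
    by split; first exact: closed_openC.
  apply: filterS => z [Nz nKz] [V [DV VA] Vz]; apply: nKz.
  by exists V; [split=> //; split=> //; exists z|exact: subset_closure].
- by apply/disjoints_subset => x Wx /interior_subset.
Qed.

(** Separation is applied twice: the Hausdorff property feeds the case of a closed set and a point,
    and the resulting regularity feeds the case of two closed sets. *)
Lemma paracompact_hausdorff_normal (R : realType) :
  paracompact X -> hausdorff_space X -> normal_space X.
Proof.
move=> pcX hsX; apply/(normal_openP (R := R)) => A B cA cB AB0.
apply: paracompact_separation => // x Ax.
have [||W [V [oW oV BW xV WV0]]] := @paracompact_separation B [set x] pcX.
- exact: cB.
- move=> y By; have /eqP yx : y <> x.
    by move=> yx; rewrite -[False]/(set0 x) -AB0; split=> //; rewrite -yx.
  move: hsX; rewrite open_hausdorff => /(_ _ _ yx)[[U V]] /= [yU xV].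
  move=> [oU oV /eqP UV0]; exists U => //; split; first exact: set_mem.
  move=> z /(disjoint_open_closure oV UV0) nVz zx; apply: nVz.
  by rewrite zx; exact: set_mem.
exists V => //; split; first exact: xV.
apply: (subset_trans (disjoint_open_closure oW _)); first by rewrite setIC.
exact: subsetC.
Qed.

End ParacompactNormal.

(** Induction on [n]: a Urysohn function vanishing off [P n] is 1 on the part of [A] missed by the
    earlier sets, so its zeros in [A] form a closed set covered by those. *)
Lemma normal_subordinate (R : realType) (X : topologicalType) (n : nat)
    (P : nat -> set X) (A : set X) :
    normal_space X -> (forall i, open (P i)) -> closed A ->
    (forall x, A x -> exists2 i, (i < n)%N & P i x) ->
  exists phi : nat -> X -> R,
    [/\ forall i, continuous (phi i), forall i x, 0 <= phi i x,
        forall i x, ~ P i x -> phi i x = 0 &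
        forall x, A x -> exists2 i, (i < n)%N & phi i x != 0].
Proof.
move=> nX oP; elim: n A => [|n IHn] A cA AP.
  exists (fun _ _ => 0); split=> // [i|x /AP[] //]; exact: cst_continuous.
pose B := A `&` ~` \bigcup_(i in `I_n) P i.
have cB : closed B.
  by apply: closedI => //; apply: open_closedC; exact: bigcup_open.
have [|u [cu u01 u0 u1]] := (@uniform_separatorP X R (~` P n) B).1.
  apply: (normal_separatorP (R := R)).1 => //; first exact: open_closedC.
  rewrite -subset0 => x [nPx [Ax nPix]]; have [i] := AP x Ax.
  rewrite ltnS leq_eqVlt => /orP[/eqP-> //|ilt Pi].
  by apply: nPix; exists i.
have [||phi [cphi phi0 phiP phiA]] := IHn (A `&` u @^-1` [set 0]).
- apply: closedI => //; apply: preimage_closed => [x _|]; first exact: cu.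
  exact: closed_eq.
- move=> x [Ax ux0]; apply: contrapT => nP.
  have /u1 : (u @` B) (u x).
    by exists x => //; split=> // -[i /= ilt Pix]; apply: nP; exists i.
  by move/eqP; rewrite ux0 eq_sym oner_eq0.
exists (fun i => if i == n then u else phi i); split=> [i|i x|i x nPx|x Ax].
- by case: ifP.
- case: ifP => // _; have /(u01 _) : range u (u x) by [].
  by rewrite /= in_itv /= => /andP[].
- case: ifPn => [/eqP iN|_]; last exact: phiP.
  by apply: u0; exists x => //=; rewrite -iN.
- have [ux0|ux0] := eqVneq (u x) 0; last by exists n; rewrite ?eqxx.
  have [i ilt phii] := phiA x (conj Ax ux0).
  by exists i; [exact: ltnW|rewrite ltn_eqF].
Qed.

(** * Orbits of an involution and the quotient map *)

Section FreeInvolution.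
Variables (X : topologicalType) (a : Z2_action X).
Local Notation tau := (a 1).

Lemma Z2_eq0_or1 (g : 'Z_2) : g = 0 \/ g = 1.
Proof.
by case: g => -[|[|//]] ?; [left|right]; apply: val_inj.
Qed.

Lemma Z2_act1K : involutive tau.
Proof. by move=> x; rewrite -Z2_actD (_ : 1 + 1 = 0) ?Z2_act0//; apply: val_inj. Qed.

Lemma orbit_projP (x y : X) :
  orbit_proj a x = orbit_proj a y <-> x = y \/ tau x = y.
Proof.
split=> [/eqmodP/existsP[g /eqP <-]|].
  by have [->|->] := Z2_eq0_or1 g; [left; rewrite Z2_act0|right].
move=> xy; apply/eqmodP/existsP.
by case: xy => <-; [exists 0; rewrite Z2_act0|exists 1].
Qed.

Lemma orbit_proj_tau (x : X) : orbit_proj a (tau x) = orbit_proj a x.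
Proof. by apply/orbit_projP; right; rewrite Z2_act1K. Qed.

Lemma orbit_proj_surj (b : orbit_space a) : exists x, orbit_proj a x = b.
Proof. by exists (repr b); exact: reprK. Qed.

Lemma orbit_proj_continuous : continuous (orbit_proj a).
Proof. exact: pi_continuous. Qed.

Lemma orbit_proj_open (O : set X) : open O -> open (orbit_proj a @` O).
Proof.
(* Openness in the quotient topology is openness of the preimage, here the union of [O] and its
   translate. *)
move=> oO; change (open (orbit_proj a @^-1` (orbit_proj a @` O))).
suff -> : orbit_proj a @^-1` (orbit_proj a @` O) = O `|` tau @^-1` O.
  by apply: openU => //; apply: open_comp => // x _; exact: Z2_act_continuous.
apply/seteqP; split=> x /=.
  by case=> y Oy /orbit_projP[<-|<-]; [left|right; rewrite /= Z2_act1K].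
case=> Ox; first by exists x.
by exists (tau x) => //; exact: orbit_proj_tau.
Qed.

(** * Local sections and open sets disjoint from their translates *)

Definition half_cover (n : nat) (V : nat -> set X) : Prop :=
  [/\ forall i, open (V i), forall i x, V i x -> ~ V i (tau x) &
      forall x, exists2 i, (i < n)%N & V i x \/ V i (tau x)].

(** The witness is the image of the section. It is open because the Hausdorff property keeps nearby
    values of the section away from translates of points near [s u]. *)
Lemma local_section_image (U : set (orbit_space a)) :
    free_Z2_space a -> open U -> has_local_section (orbit_proj a) U ->
  exists V : set X, [/\ open V, forall x, V x -> ~ V (tau x) &
    forall x, U (orbit_proj a x) -> V x \/ V (tau x)].
Proof.
move=> [hsX freeX] oU [s [cs sE]].
have sP u : orbit_proj a (s u) = \val u by rewrite -[LHS]/((_ \o s) u) sE.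
have tau_neq x : tau x != x.
  by apply/eqP => /freeX /eqP; rewrite oner_eq0.
exists (range s); split.
- rewrite openE => _ [u _ <-]; rewrite /interior.
  move: hsX; rewrite open_hausdorff => /(_ _ _ (tau_neq (s u)))[[M N]] /=.
  move=> [/set_mem Mx /set_mem Nx] [oM oN /eqP MN0].
  have [_ [[O oO <-] Ou ON]] : nbhs u (s @^-1` N).
    by apply: cs; exact: open_nbhs_nbhs.
  have nbU : nbhs (s u) (orbit_proj a @^-1` (O `&` U)).
    apply: orbit_proj_continuous; rewrite sP; apply: open_nbhs_nbhs.
    by split; [exact: openI|split=> //; exact: set_valP].
  have nbM : nbhs (s u) (tau @^-1` M).
    by apply: Z2_act_continuous; exact: open_nbhs_nbhs.
  apply: filterS (filterI nbU nbM) => y [[Oy Uy] My].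
  pose v : U := exist (fun b => b \in U) _ (mem_set Uy).
  have Nv : N (s v) by apply: ON.
  (* [s v] is [y] or its translate; the latter would put [s v] in both [M] and [N]. *)
  exists v => //; have /orbit_projP[//|vy] :
    orbit_proj a (s v) = orbit_proj a y by rewrite sP.
  have : (M `&` N) (s v) by split=> //; rewrite -[s v]Z2_act1K vy.
  by rewrite MN0.
- move=> _ [u _ <-] [v _ vu].
  have uv : v = u by apply: val_inj; rewrite -!sP vu orbit_proj_tau.
  by move: vu; rewrite uv => /esym/eqP; rewrite (negPf (tau_neq _)).
- move=> x Ux; pose v : U := exist (fun b => b \in U) _ (mem_set Ux).
  have /orbit_projP[vx|vx] : orbit_proj a (s v) = orbit_proj a x by rewrite sP.
    by left; exists v.
  by right; exists v => //; rewrite -vx Z2_act1K.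
Qed.

(** On [V] the quotient map is injective and open, so its inverse is a continuous section. *)
Lemma local_section_half (V : set X) :
    open V -> (forall x, V x -> ~ V (tau x)) ->
  has_local_section (orbit_proj a) (orbit_proj a @` V).
Proof.
move=> oV Vtau.
have /choice[s sP] (u : orbit_proj a @` V) :
    exists x, V x /\ orbit_proj a x = \val u.
  by have [x Vx xu] := set_valP u; exists x.
exists s; split; last by apply/funext => u; exact: (sP u).2.
move=> u W; rewrite nbhsE => -[O [oO Ou] OW].
(* Representatives in [V] are unique, so over the projection of [O] intersected with [V] the section
   takes values in [O]. *)
exists (\val @^-1` (orbit_proj a @` (O `&` V))); split.
- by exists (orbit_proj a @` (O `&` V)) => //; exact/orbit_proj_open/openI.
- by exists (s u); [split=> //; exact: (sP u).1|exact: (sP u).2].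
- move=> v /= [w [Ow Vw] wv]; apply: OW; have [Vv vE] := sP v.
  have /orbit_projP[->//|vw] : orbit_proj a (s v) = orbit_proj a w.
    by rewrite vE wv.
  by have := Vtau _ Vv; rewrite vw.
Qed.

Lemma secat_cover_half_cover (n : nat) (C : set (set (orbit_space a))) :
    free_Z2_space a -> (C #= `I_n)%card -> open_cover C ->
    (forall U, C U -> has_local_section (orbit_proj a) U) ->
  exists V, half_cover n V.
Proof.
move=> frX /card_eqPle[Cn _] [oC covC] secC.
have /pcard_surjP[U surjU] := Cn.
have /choice[V VP] (i : nat) : exists V : set X,
    [/\ open V, forall x, V x -> ~ V (tau x) &
      C (U i) -> forall x, U i (orbit_proj a x) -> V x \/ V (tau x)].
  (* The surjection onto [C] may leave [C] at some indices; the empty set serves there. *)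
  have [CU|nCU] := pselect (C (U i)); last by exists set0; split=> //; exact: open0.
  have [V [oV Vtau VU]] := local_section_image frX (oC _ CU) (secC _ CU).
  by exists V.
exists V; split=> [i|i|x]; [by case: (VP i)|by case: (VP i)|].
have : [set: orbit_space a] (orbit_proj a x) by [].
rewrite -covC => -[W CW Wx]; have [i iltn iW] := surjU W CW.
by exists i => //; have [_ _] := VP i; rewrite iW; apply.
Qed.

(** Different indices may give the same projection, so the cover may have fewer than [n] members. *)
Lemma half_cover_secat_cover (n : nat) (V : nat -> set X) :
    half_cover n V ->
  exists2 m, (m <= n)%N & exists C : set (set (orbit_space a)),
    [/\ (C #= `I_m)%card, open_cover C &
      forall U, C U -> has_local_section (orbit_proj a) U].
Proof.
move=> [oV Vtau covV]; pose C := (fun i => orbit_proj a @` V i) @` `I_n.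
have CI : (C #<= `I_n)%card by exact: card_image_le.
have /finite_setP[m Cm] : finite_set C by apply/finite_set_leP; exists n.
exists m; first by rewrite -card_le_II -(card_le_eql Cm).
exists C; split=> //; last by move=> _ [i _ <-]; exact: local_section_half (oV i) (Vtau i).
split; first by move=> _ [i _ <-]; exact: orbit_proj_open.
rewrite -subTset => b _; have [x <-] := orbit_proj_surj b.
have [i iltn Vi] := covV x; exists (orbit_proj a @` V i); first by exists i.
by case: Vi => Vx; [exists x|exists (tau x) => //; exact: orbit_proj_tau].
Qed.

(** * Equivariant maps into the configuration space *)

Lemma equivariant_map_half_cover (R : realType) (k : nat)
    (f : X -> conf2 'rV[R]_k.+1) :
    continuous f -> equivariant a (conf2_Z2 'rV[R]_k.+1) f ->
  exists V, half_cover k.+1 V.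
Proof.
(* Coordinate differences are odd under [tau], and at each point some one is nonzero. *)
move=> cf ef; pose d i x := (\val (f x)).1 ord0 i - (\val (f x)).2 ord0 i.
have dtau i x : d i (tau x) = - d i x by rewrite /d ef /= opprB.
have cd i : continuous (d i).
  have cv : continuous (fun x => \val (f x)).
    move=> x; apply: (@continuous_comp _ _ _ f set_val); first exact: cf.
    exact: initial_continuous.
  move=> x; apply: cvgB.
    apply: (@continuous_comp _ _ _ (fun x => (\val (f x)).1)
      (fun M : 'rV[R]_k.+1 => M ord0 i)); last exact: coord_continuous.
    by apply: (@continuous_comp _ _ _ (fun x => \val (f x)) fst);
      [exact: cv|exact: cvg_fst].
  apply: (@continuous_comp _ _ _ (fun x => (\val (f x)).2)
    (fun M : 'rV[R]_k.+1 => M ord0 i)); last exact: coord_continuous.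
  by apply: (@continuous_comp _ _ _ (fun x => \val (f x)) snd);
    [exact: cv|exact: cvg_snd].
(* [inord] extends the family to all natural indices; those up to [k] already cover. *)
exists (fun i => [set x | 0 < d (inord i) x]); split=> [i|i x|x] /=.
- apply: (@open_comp _ _ (d (inord i)) [set y | 0 < y]); last exact: open_gt.
  by move=> x _; exact: cd.
- by rewrite dtau oppr_gt0 => /ltW; rewrite leNgt => /negP.
- have [i di] : exists i, d i x != 0.
    apply: contrapT => nd; apply: (set_valP (f x)); apply/rowP => i.
    apply/eqP; rewrite -subr_eq0; apply: contrapT => /negP di.
    by apply: nd; exists i.
  exists i => //; rewrite dtau oppr_gt0 inord_val.
  by move: di; rewrite neq_lt => /orP[]; [right|left].
Qed.

Lemma half_cover_equivariant_map (R : realType) (k : nat) (V : nat -> set X) :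
    normal_space X -> half_cover k.+1 V ->
  exists f : X -> conf2 'rV[R]_k.+1,
    continuous f /\ equivariant a (conf2_Z2 'rV[R]_k.+1) f.
Proof.
move=> nX [oV Vtau covV]; have ctau : continuous tau by exact: Z2_act_continuous.
have otV i : open (tau @^-1` V i).
  by apply: open_comp => // x _; exact: ctau.
have [||phi [cphi phi0 phiV phiA]] :=
    @normal_subordinate R X k.+1 (fun i => V i `|` tau @^-1` V i) setT nX _
      closedT.
- by move=> i; exact: openU.
- by move=> x _; exact: covV.
(* Symmetrizing gives invariance under [tau]; nonnegativity of [phi] prevents cancellation. *)
pose psi i x := phi i x + phi i (tau x).
have psi_tau i x : psi i (tau x) = psi i x by rewrite /psi Z2_act1K addrC.
have psi0 i x : 0 <= psi i x by exact: addr_ge0.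
have cpsi i : continuous (psi i).
  move=> x; apply: cvgD; first exact: cphi.
  by apply: continuous_comp; [exact: ctau|exact: cphi].
have psiV i x : ~ V i x -> ~ V i (tau x) -> psi i x = 0.
  move=> nVx nVtx; rewrite /psi !phiV ?addr0// => -[] //=.
  by rewrite Z2_act1K.
pose h i x : R := if x \in V i then psi i x else 0.
have h0 i x : ~ V i x -> h i x = 0 by rewrite /h; case: ifPn => // /set_mem.
have hV i x : V i x -> h i x = psi i x by move=> /mem_set Vx; rewrite /h Vx.
(* Three cases: on [V i] the map is [psi i], on its translate it vanishes, and elsewhere it is
   squeezed between 0 and [psi i], which is 0 at [x]. *)
have ch i : continuous (h i).
  move=> x; have [Vx|nVx] := pselect (V i x).
    rewrite /continuous_at hV//; apply: cvg_trans (cpsi i x).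
    apply: near_eq_cvg; apply: filterS (open_nbhs_nbhs (conj (oV i) Vx)).
    by move=> y Vy; rewrite hV.
  rewrite /continuous_at h0//.
  have [Vtx|nVtx] := pselect (V i (tau x)).
    have cst0 : (0 : R) @[_ --> x] --> (0 : R) by exact: cvg_cst.
    apply: cvg_trans cst0.
    apply: near_eq_cvg; apply: filterS (open_nbhs_nbhs (conj (otV i) Vtx)).
    by move=> y Vty; rewrite h0// => /Vtau.
  apply: (squeeze_cvgr (f := cst 0) (h := psi i)).
  - apply: nearW => y; rewrite /h; case: ifP => _; first by rewrite psi0 lexx.
    by rewrite lexx psi0.
  - exact: cvg_cst.
  - by rewrite -(psiV i x nVx nVtx); exact: cpsi.
pose H x : 'rV[R]_k.+1 := \row_i h i x.
have cH : continuous H.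
  move=> x A [B nB BA].
  have : \forall y \near x, forall i : 'I_k.+1, B ord0 i (h i y).
    apply: filter_forall => i; apply: ch.
    by have := nB ord0 i; rewrite mxE.
  by apply: filterS => y By; apply: BA => i j; rewrite ord1 mxE; exact: By.
have cHH : continuous (fun x => (H x, H (tau x))).
  move=> x; have cHtau : H (tau y) @[y --> x] --> H (tau x).
    by apply: continuous_comp; [exact: ctau|exact: cH].
  exact: cvg_pair (cH x) cHtau.
have HtauP x : (H x, H (tau x)) \in conf2 'rV[R]_k.+1.
  apply/mem_set => /= /rowP eqH.
  have [i iltk phin0] := phiA x I; have := eqH (Ordinal iltk).
  rewrite !mxE /=; apply/eqP.
  have psin0 : psi i x != 0.
    by rewrite gt_eqF// ltr_pwDl// lt_def phin0 phi0.
  (* Exactly one of [x] and [tau x] lies in [V i], so the [i]-th coordinates of [H x] and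
     [H (tau x)] are [psi i x] and 0 in some order. *)
  have [Vx|nVx] := pselect (V i x).
    by rewrite hV// h0//; exact: Vtau.
  have [Vtx|nVtx] := pselect (V i (tau x)).
    by rewrite h0// hV// psi_tau eq_sym.
  by move: psin0; rewrite psiV// eqxx.
exists (fun x => exist (fun z => z \in conf2 _) (H x, H (tau x)) (HtauP x)).
split.
  by apply: continuous_comp_initial => x; exact: cHH.
move=> g x; have [->|->] := Z2_eq0_or1 g; apply: val_inj => /=.
  by rewrite Z2_act0.
by rewrite Z2_act1K.
Qed.

End FreeInvolution.

Theorem corollary4p1 (R : realType) (X : topologicalType) (a : Z2_action X)
    (hX : free_Z2_space a) (hne : [set: X] !=set0) (hpc : paracompact X) :
  secat (orbit_proj a) = (ind2 R a + 1%:E)%E.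
Proof.
apply: least_succ => [m [C [Cm covC secC]]|k [f [cf ef]]].
  have [V hV] := secat_cover_half_cover hX Cm covC secC.
  (* A point of [X] rules out [m = 0], so [m] is a successor [k.+1]. *)
  case: m {Cm} hV => [[_ _ /(_ (projT1 (cid hne)))[]]//|k hV]; exists k => //.
  apply: half_cover_equivariant_map hV.
  exact: paracompact_hausdorff_normal hpc hX.1.
have [V] := equivariant_map_half_cover cf ef.
exact: half_cover_secat_cover.
Qed.
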